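(* Let $S$ be a PI-ring, let $m \in \mathbb{N}$, and let $A \in \mathbb{M}_m(S)$. Then for any positive integer $n$, if $A^n = A^{n+1}X$ for some $X \in \mathbb{M}_m(S)$, then $A^n = YA^{n+1}$ for some $Y \in \mathbb{M}_m(S)$.
   Context: Rings are associative with unity, not necessarily commutative. $\mathbb{M}_m(S)$ denotes the ring of $m \times m$ matrices over $S$. A ring $S$ is a PI-ring (polynomial identity ring) if it satisfies a monic polynomial $g \in \mathbb{Z}\langle x_1, \dots, x_k\rangle$ in noncommuting indeterminates $x_1,\dots,x_k$, i.e. $g(s_1,\dots,s_k)=0$ for all $s_1,\dots,s_k \in S$; here monic means (the usual convention) that at least one monomial of highest total degree in $g$ has coefficient $1$. *)

(* Defs.v *)
From mathcomp Require Export all_boot all_order all_algebra.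
From mathcomp Require Export finmap monalg.

Set Implicit Arguments.
Unset Strict Implicit.
Unset Printing Implicit Defensive.

Import GRing.Theory.
Local Open Scope ring_scope.

(* Z<x_0, ..., x_(k-1)>, as the monoid algebra over int of the free monoid on
   'I_k: a monomial w : {fmonom 'I_k} coerces to its word, a seq 'I_k. *)
Definition ncpoly (k : nat) : nzRingType := {malg int[{fmonom 'I_k}]}.

(* This is monalg's mmap, which cannot be used here because it requires a
   nontrivial target ring. The order of the factors of the product is that of
   the word w. *)
Definition nceval (S : pzRingType) (k : nat) (s : 'I_k -> S) (g : ncpoly k) : S :=
  \sum_(w <- msupp g) (\prod_(i <- w) s i) *~ g@_w.

(* A monic g may have several monomials of highest degree: one of them must
   have coefficient 1, the others are unconstrained. *)
Definition ncmonic (k : nat) (g : ncpoly k) : Prop :=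
  exists2 w : {fmonom 'I_k}, g@_w = 1
    & forall w' : {fmonom 'I_k}, w' \in msupp g -> (fdeg w' <= fdeg w)%N.

Definition PI_ring (S : pzRingType) : Prop :=
  exists (k : nat) (g : ncpoly k),
    ncmonic g /\ forall s : 'I_k -> S, nceval s g = 0.

(* Main.v *)
Require Import Defs.
From mathcomp Require Import boolp.
From mathcomp Require classical_sets.
Set Implicit Arguments.
Unset Strict Implicit.
Unset Printing Implicit Defensive.

Import GRing.Theory.
Local Open Scope ring_scope.

(* For b = A^n the hypothesis gives b = b^2 z, and it suffices to find w with
   b = w b^2. If there is none, Zorn's lemma gives an ideal P of S that is
   maximal among those modulo which there is none, and P is prime: if IJ lies
   in P and w exists modulo I and modulo J, then b^2 is in M_m(S) b^3 modulo P,
   which with b = b^2 z yields w modulo P.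
   Modulo a prime P, left multiplication by b is injective on b M_m(S), which
   again yields w: if b^2 t = 0 but (b t)_{pq} <> 0, the rows r_k = (b^k)_p and
   the columns c_l = (b z^l t)^q satisfy r_k c_l = 0 for l < k and
   r_k c_k = (b t)_{pq}. No such infinite triangular system exists over a prime
   PI-ring: a multilinear identity of S (obtained by polarizing g) gives right
   combinations of the c_l whose last coordinate vanishes, and so a triangular
   system in one dimension less. *)

(** * Multilinear forms in noncommuting variables *)

Section MultilinearForms.
Variables (S : pzRingType) (I : eqType).
Implicit Types (s : seq I) (a : seq I -> int) (y : I -> S).

(** Coefficients are a function on words, so that [a \o cons z] gives those of the form left after a
    first letter [z] is removed. *)
Definition mlin s a y : S :=
  \sum_(u <- permutations s) (\prod_(i <- u) y i) *~ a u.

Lemma eq_mlin s a y y' : {in s, y =1 y'} -> mlin s a y = mlin s a y'.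
Proof.
move=> eqy; apply: eq_big_seq => u; rewrite mem_permutations => su.
by congr (_ *~ _); apply: eq_big_seq => i; rewrite (perm_mem su) => /eqy.
Qed.

Lemma mlin_cons x s a y : uniq (x :: s) ->
  mlin (x :: s) a y = y x * mlin s (a \o cons x) y
    + \sum_(z <- s) y z * mlin (rem z (x :: s)) (a \o cons z) y.
Proof.
move=> uxs; rewrite /mlin (perm_big _ (permutationsE _)) //=.
have /andP[/negPf-> us] := uxs.
rewrite undup_id // big_allpairs_dep big_cons /= eqxx; congr (_ + _).
  by rewrite mulr_sumr; apply: eq_bigr => u _; rewrite big_cons mulrzAr.
apply: eq_bigr => z _.
by rewrite mulr_sumr; apply: eq_bigr => u _; rewrite big_cons mulrzAr.
Qed.

End MultilinearForms.

(** * Two-sided ideals, as predicates *)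

Section Ideals.
Variable S : pzRingType.

Record ideal (P : S -> Prop) : Prop := Ideal {
  ideal0 : P 0;
  idealD : forall x y, P x -> P y -> P (x + y);
  idealM : forall x y z, P y -> P (x * y * z) }.

Variables (P : S -> Prop) (idP : ideal P).

Lemma idealMl x y : P y -> P (x * y).
Proof. by move=> Py; rewrite -[x * y]mulr1; apply: (idealM idP). Qed.

Lemma idealMr x y : P x -> P (x * y).
Proof. by move=> Px; rewrite -[x]mul1r; apply: (idealM idP). Qed.

Lemma idealN x : P x -> P (- x).
Proof. by move=> Px; rewrite -mulN1r; apply: idealMl. Qed.

Lemma idealB x y : P x -> P y -> P (x - y).
Proof. by move=> Px Py; apply: (idealD idP) => //; apply: idealN. Qed.

Lemma ideal_sum (J : eqType) (r : seq J) (F : J -> S) :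
  (forall j, j \in r -> P (F j)) -> P (\sum_(j <- r) F j).
Proof.
by move=> PF; rewrite big_seq; apply: big_ind => //; [apply: ideal0 | apply: idealD].
Qed.

End Ideals.

(** * Infinite triangular systems modulo a prime ideal *)

Section TriangularSystems.
Variables (S : pzRingType) (P : S -> Prop).
Hypothesis idP : ideal P.
Hypothesis primeP : forall x y, (forall t, P (x * t * y)) -> P x \/ P y.

Definition pairing m (r c : nat -> S) : S := \sum_(i < m) r i * c i.

(** Modulo [P] the matrix of pairings is upper triangular with nonzero diagonal entries; above the
    diagonal it is arbitrary. *)
Definition triangular m (r c : nat -> nat -> S) :=
  (forall k l, (l < k)%N -> P (pairing m (r k) (c l)))
  /\ forall k, ~ P (pairing m (r k) (c k)).

(** Greedy choice: each new row index is taken beyond the previous one, so its row is orthogonal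
    modulo [P] to all columns chosen before. *)
Lemma triangular_subseq m (r : nat -> nat -> S) :
  (forall N, exists p : nat * (nat -> S), [/\ (N <= p.1)%N,
     ~ P (pairing m (r p.1) p.2)
     & forall k, (p.1 < k)%N -> P (pairing m (r k) p.2)]) ->
  exists r' c', triangular m r' c'.
Proof.
move=> /choice[f fP]; pose K n := iter n (fun p => f p.1.+1) (f 0%N).
have KP n : ~ P (pairing m (r (K n).1) (K n).2)
    /\ forall k, ((K n).1 < k)%N -> P (pairing m (r k) (K n).2).
  by case: n => [|n] /=; [case: (fP 0%N) | case: (fP (K n).1.+1)].
have Kmono : {homo (fun n => (K n).1) : i j / (i < j)%N}.
  by apply: homo_ltn => [? ? ?|n /=]; [apply: ltn_trans | case: (fP (K n).1.+1)].
exists (fun n => r (K n).1), (fun n => (K n).2); split=> [k l lk|k].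
  by apply: (KP l).2; apply: Kmono.
exact: (KP k).1.
Qed.

(* If the form s vanishes on the values c_l,m * t_i, its expansion mlin_cons
   combines columns into one whose coordinate m lies in P and whose pairing with
   the row of largest index is a multiple of the form with the first letter of s
   removed. When that shorter form vanishes as well (for large l), recurse on
   it; the empty form is the constant 1. *)
Lemma triangular_eliminate m (r c : nat -> nat -> S) (I : eqType) (s : seq I)
    (a : seq I -> int) :
  triangular m.+1 r c -> uniq s -> a s = 1 ->
  (exists N, forall (l : I -> nat) (t : I -> S), (forall i, N <= l i)%N ->
     P (mlin s a (fun i => c (l i) m * t i))) ->
  exists r' c', triangular m r' c'.
Proof.
move=> [Tlow Tdiag]; elim: s a => [|x s IHs] a us a1 [N vanish].
  case: (Tdiag 0%N); rewrite -[pairing _ _ _]mul1r; apply: idealMr => //.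
  have := vanish (fun=> N) (fun=> 0) (fun=> leqnn N).
  by rewrite /mlin big_seq1 big_nil a1.
have [van|nvanish] := pselect (exists N, forall (l : I -> nat) (t : I -> S),
  (forall i, N <= l i)%N ->
  P (mlin s (a \o cons x) (fun i => c (l i) m * t i))).
  by apply: (IHs (a \o cons x)) => //; case/andP: us.
apply: (@triangular_subseq m r) => N'.
have [l [t [leNl nPG]]] : exists (l : I -> nat) (t : I -> S),
    (forall i, maxn N N' <= l i)%N /\
    ~ P (mlin s (a \o cons x) (fun i => c (l i) m * t i)).
  apply: contrapT => none; apply: nvanish; exists (maxn N N') => l t leNl.
  by apply: contrapT => nPG; apply: none; exists l, t.
set G := mlin _ _ _ in nPG.
(* Beyond every [l z], so that the rows from [k] on are orthogonal modulo [P] to all the columns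
   [c (l z)]. *)
pose k := (maxn (maxn N N') (\max_(z <- s) l z)).+1.
have ltlk z : z \in s -> (l z < k)%N.
  by move=> sz; rewrite ltnS leq_max (leq_bigmax_seq _ sz) ?orbT.
have [leNk leN'k] : (N <= k)%N /\ (N' <= k)%N.
  by split; rewrite leqW// !leq_max leqnn ?orbT.
have [tau nPtau] : exists tau, ~ P (pairing m.+1 (r k) (c k) * tau * G).
  apply: contrapT => none; case: (@primeP (pairing m.+1 (r k) (c k)) G) => // [tau|].
    by apply: contrapT => nP; apply: none; exists tau.
  exact: Tdiag.
pose y i := c (if i == x then k else l i) m * (if i == x then tau else t i).
pose h z := mlin (rem z (x :: s)) (a \o cons z) y.
(* The coefficients are read off [mlin_cons]: coordinate [m] of [c'] is the value at [y] of the form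
   for [x :: s]. *)
pose c' i := c k i * (tau * G) + \sum_(z <- s) c (l z) i * (t z * h z).
have c'm : P (c' m).
  have leNl' i : (N <= if i == x then k else l i)%N.
    by case: eqP => // _; apply: leq_trans (leNl i); apply: leq_maxl.
  have := vanish _ (fun i => if i == x then tau else t i) leNl'.
  rewrite mlin_cons // eqxx.
  suff -> : mlin s (a \o cons x) y = G.
    congr (P _); rewrite /c' mulrA; congr (_ + _); apply: eq_big_seq => z sz.
    rewrite mulrA; case: eqP => // zx; by move: us; rewrite /= -zx sz.
  apply: eq_mlin => z sz; rewrite /y; case: eqP => // zx.
  by move: us; rewrite /= -zx sz.
(* The pairing with [c'] is computed twice. Dropping coordinate [m] changes it by a multiple of
   [c' m], which lies in [P]; expanding [c'] leaves, modulo [P] and for [j >= k], only the term of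
   [c k]. *)
have pairS j : pairing m.+1 (r j) c' = pairing m (r j) c' + r j m * c' m.
  by rewrite /pairing big_ord_recr.
have pairE j : pairing m.+1 (r j) c' = pairing m.+1 (r j) (c k) * tau * G
    + \sum_(z <- s) pairing m.+1 (r j) (c (l z)) * (t z * h z).
  rewrite /pairing; under eq_bigr do rewrite mulrDr.
  rewrite big_split /= -mulrA mulr_suml; congr (_ + _).
    by apply: eq_bigr => i _; rewrite mulrA.
  under eq_bigr do rewrite mulr_sumr.
  rewrite exchange_big; apply: eq_bigr => z _; rewrite mulr_suml.
  by apply: eq_bigr => i _; rewrite mulrA.
have tailP j : (k <= j)%N ->
    P (\sum_(z <- s) pairing m.+1 (r j) (c (l z)) * (t z * h z)).
  move=> lekj; apply: ideal_sum => // z sz; apply: idealMr => //.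
  by apply: Tlow; apply: leq_trans lekj; apply: ltlk.
exists (k, c'); split=> //= [Pk|j ltkj].
  apply: nPtau; rewrite -[X in P X](addrK
    (\sum_(z <- s) pairing m.+1 (r k) (c (l z)) * (t z * h z))).
  rewrite -pairE pairS; apply: idealB => //; last exact: tailP.
  by apply: idealD => //; apply: idealMl.
rewrite -[X in P X](addrK (r j m * c' m)) -pairS pairE.
apply: idealB => //; last exact: idealMl.
apply: idealD => //; last exact/tailP/ltnW.
by rewrite -mulrA; apply: idealMr => //; apply: Tlow.
Qed.

Lemma no_triangular m (I : eqType) (s : seq I) (a : seq I -> int) r c :
  uniq s -> a s = 1 -> (forall y : I -> S, mlin s a y = 0) -> ~ triangular m r c.
Proof.
move=> us a1 id0; elim: m r c => [|m IHm] r c T.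
  by case: T => _ /(_ 0%N); apply; rewrite /pairing big_ord0; apply: ideal0.
have [|r' [c' /IHm//]] := triangular_eliminate T us a1.
by exists 0%N => l t _; rewrite id0; apply: ideal0.
Qed.

End TriangularSystems.

(** * Left regularity of [b] modulo an ideal, given [b = b * b * z] *)

Section StronglyRegularModulo.
Variables (R : pzRingType) (b z : R).
Hypothesis bbz : b = b * b * z.

Definition left_regular_mod (Q : R -> Prop) := exists w, Q (b - w * b * b).

(** Since [b * b * (1 - z * b) = 0], cancelling [b] once gives [b = b * z * b] modulo [Q], and once
    more [b * z = b * z * z * b]; together [b = (b * z * z) * b * b]. *)
Lemma left_regular_of_injective (Q : R -> Prop) : ideal Q ->
  (forall t, Q (b * b * t) -> Q (b * t)) -> left_regular_mod Q.
Proof.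
move=> idQ inj.
have Qk : Q (b * (1 - z * b)).
  by apply: inj; rewrite mulrBr mulr1 !mulrA -bbz subrr; apply: ideal0.
have Ql : Q (b * (z * (1 - z * b))) by apply: inj; rewrite !mulrA -bbz.
exists (b * z * z).
suff -> : b - b * z * z * b * b = b * (1 - z * b) + b * (z * (1 - z * b)) * b.
  by apply: (idealD idQ) => //; apply: (idealMr idQ).
by rewrite !mulrBr !mulr1 mulrBl !mulrA addrA subrK.
Qed.

(** Modulo [Q], [b * t = b^2 * z * t = Y * b^3 * z * t = Y * b^2 * t], so left multiplication by [b]
    is injective on multiples of [b]. *)
Lemma left_regular_of_square (Q : R -> Prop) (Y : R) : ideal Q ->
  Q (b * b - Y * b * b * b) -> left_regular_mod Q.
Proof.
move=> idQ Qb; apply: left_regular_of_injective => // t Qt.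
have -> : b * t = (b * b - Y * b * b * b) * (z * t) + Y * (b * b * t).
  have -> : b * b - Y * b * b * b = b * b - Y * b * (b * b) by rewrite !mulrA.
  by rewrite mulrA mulrBl -bbz -(mulrA _ _ z) -bbz mulrBl !mulrA subrK.
by apply: (idealD idQ); [apply: (idealMr idQ) | apply: (idealMl idQ)].
Qed.

Lemma left_regular_of_mul (QI QJ Q : R -> Prop) : ideal Q ->
  (forall x t y, QI x -> QJ y -> Q (x * t * y)) ->
  left_regular_mod QI -> left_regular_mod QJ -> left_regular_mod Q.
Proof.
move=> idQ QIJ [w Qw] [v Qv]; set n1 := b - _ in Qw; set n2 := b - _ in Qv.
(* From [n1 * b = b^2 - w * b^3], replacing [b] by [n2 + v * b^2] twice to the right of [n1] leaves
   terms containing both [n1] and [n2], and [n1 * v * v * b^3]. *)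
apply: (@left_regular_of_square Q (w + n1 * v * v)) => //.
have -> : b * b - (w + n1 * v * v) * b * b * b = n1 * 1 * n2 + n1 * v * n2 * b.
  rewrite mulr1; have -> : n1 * n2 = n1 * b - n1 * v * b * b.
    by rewrite /n2 mulrBr !mulrA.
  have -> : n1 * v * n2 * b = n1 * v * b * b - n1 * v * v * b * b * b.
    by rewrite {1}/n2 mulrBr mulrBl !mulrA.
  by rewrite addrA subrK {1}/n1 mulrBl !mulrDl opprD addrA !mulNr.
by apply: (idealD idQ); [|apply: (idealMr idQ)]; apply: QIJ.
Qed.

End StronglyRegularModulo.

(** Finitely many elements of the union of a chain lie in a single member. This serves for the
    entries of a matrix. *)
Lemma chain_seq (T : Type) (C : (T -> Prop) -> Prop) :
  classical_sets.total_on C classical_sets.subset -> (exists A, C A) ->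
  forall (J : eqType) (r : seq J) (x : J -> T),
    (forall j, exists2 A, C A & A (x j)) ->
    exists2 A, C A & forall j, j \in r -> A (x j).
Proof.
move=> totC [A0 CA0] J r x Cx; elim: r => [|j r [A CA Ar]]; first by exists A0.
have [B CB Bj] := Cx j.
have [sAB|sBA] := totC _ _ CA CB.
  by exists B => // i; rewrite inE => /orP[/eqP->//|/Ar/sAB].
by exists A => // i; rewrite inE => /orP[/eqP->|/Ar//]; apply: sBA.
Qed.

(** * Ideals of the matrix ring induced by ideals of [S] *)

Section MatrixIdeals.
Variables (S : pzRingType) (m : nat).
Implicit Types P : S -> Prop.

Definition mx_ideal P (X : 'M[S]_m) := forall i j, P (X i j).

Lemma mx_idealP P : ideal P -> ideal (mx_ideal P).
Proof.
move=> idP; split=> [i j|X Y PX PY i j|X Y Z PY i j].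
- by rewrite mxE; apply: ideal0.
- by rewrite mxE; apply: idealD.
rewrite mxE; apply: ideal_sum => // k _; apply: idealMr => //.
by rewrite mxE; apply: ideal_sum => // l _; apply: idealMl.
Qed.

Lemma mx_ideal_mul (PI PJ P : S -> Prop) : ideal P ->
  (forall x t y, PI x -> PJ y -> P (x * t * y)) ->
  forall X T Y, mx_ideal PI X -> mx_ideal PJ Y -> mx_ideal P (X * T * Y).
Proof.
move=> idP PIJ X T Y PX PY i j; rewrite mxE; apply: ideal_sum => // k _.
rewrite mxE mulr_suml; apply: ideal_sum => // l _; exact: PIJ.
Qed.

(** * The prime case, and the reduction to it by Zorn's lemma *)

Section Prime.
Variables (I : eqType) (s : seq I) (a : seq I -> int).
Hypotheses (us : uniq s) (a1 : a s = 1).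
Hypothesis id0 : forall y : I -> S, mlin s a y = 0.
Variables (b z : 'M[S]_m).
Hypothesis bbz : b = b * b * z.

Lemma mx_injective_mod_prime P : ideal P ->
  (forall x y, (forall t, P (x * t * y)) -> P x \/ P y) ->
  forall t, mx_ideal P (b * b * t) -> mx_ideal P (b * t).
Proof.
move=> idP primeP t Pbbt p q; apply: contrapT => nPc.
have bXz n : b ^+ n * (b * z ^+ n) = b.
  elim: n => [|n IHn]; first by rewrite mul1r mulr1.
  have -> : b ^+ n.+1 * (b * z ^+ n.+1) = b ^+ n * (b * b * z * z ^+ n).
    by rewrite exprSr exprS !mulrA.
  by rewrite -bbz.
pose r k i := (b ^+ k) p i; pose c l i := (b * z ^+ l * t) i q.
(* Padding by zero: coordinates of triangular systems are indexed by [nat], which lets the dimension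
   drop by induction. *)
pose ext (f : 'I_m -> S) n := oapp f 0 (insub n).
have pairE k l : pairing m (ext (r k)) (ext (c l)) = (b ^+ k * (b * z ^+ l * t)) p q.
  rewrite mxE; apply: eq_bigr => i _.
  by rewrite /ext !valK.
apply: (@no_triangular S P idP primeP m I s a (ext \o r) (ext \o c)) => //.
split=> [k l ltlk|k]; rewrite /= pairE.
  (* With [b^l * (b * z^l) = b] the product becomes [b^(k-l) * (b * t)], which ends in [b * b * t]
     because [l < k]. *)
  rewrite -(subnK (ltnW ltlk)) exprD -mulrA (mulrA (b ^+ l)) bXz.
  have := ltlk; rewrite -subn_gt0; case: (k - l)%N => // n _.
  by rewrite exprSr -mulrA (mulrA b b); apply: (idealMl (mx_idealP idP)).
by rewrite mulrA bXz.
Qed.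

Definition mx_left_regular_mod P := left_regular_mod b (mx_ideal P).

Lemma mx_left_regular_mod_prime P : ideal P ->
  (forall x y, (forall t, P (x * t * y)) -> P x \/ P y) -> mx_left_regular_mod P.
Proof.
move=> idP primeP; apply: left_regular_of_injective bbz _ (mx_idealP idP) _.
exact: mx_injective_mod_prime.
Qed.

(** A witness [w] modulo the union of a chain concerns only the finitely many entries of
    [b - w * b * b], hence is already one modulo some member. *)
Lemma exists_maximal_not_regular : ~ mx_left_regular_mod (fun x => x = 0) ->
  exists P, [/\ ideal P, ~ mx_left_regular_mod P
    & forall Q, ideal Q -> (forall x, P x -> Q x) -> ~ mx_left_regular_mod Q ->
      forall x, Q x -> P x].
Proof.
move=> nreg0.
have id0S : ideal (fun x : S => x = 0).
  split=> // [x y -> ->|x y w ->]; first by rewrite addr0.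
  by rewrite mulr0 mul0r.
(* The empty set is admitted as the union of the empty chain. *)
pose bad (A : classical_sets.set S) :=
  (forall x, ~ A x) \/ ideal A /\ ~ mx_left_regular_mod A.
have [C sC totC|P [badP maxP]] := @classical_sets.Zorn_bigcup S bad.
  have [[A0 [CA0 [x0 Ax0]]]|empty] :=
    pselect (exists A, C A /\ exists x, A x); last first.
    by left=> x [A CA Ax]; apply: empty; exists A; split=> //; exists x.
  have memC A x : C A -> A x -> ideal A /\ ~ mx_left_regular_mod A.
    by move=> CA Ax; case: (sC _ CA) => [/(_ x)|].
  right; split; first split.
  - by exists A0 => //; apply: (ideal0 (memC _ _ CA0 Ax0).1).
  - move=> x y [A CA Ax] [B CB By].
    have [sAB|sBA] := totC _ _ CA CB.
      by exists B => //; apply: (idealD (memC _ _ CB By).1) => //; apply: sAB.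
    by exists A => //; apply: (idealD (memC _ _ CA Ax).1) => //; apply: sBA.
  - move=> x y w [A CA Ay]; exists A => //.
    exact: (idealM (memC _ _ CA Ay).1).
  case=> w Uw.
  have [||ij|A [CA [_ nA]] Aw] := @chain_seq S
      (fun A => C A /\ ideal A /\ ~ mx_left_regular_mod A) _ _ _
      (enum {: 'I_m * 'I_m}) (fun ij => (b - w * b * b) ij.1 ij.2).
  - by move=> A B [CA _] [CB _]; apply: totC.
  - by exists A0; split=> //; apply: memC Ax0.
  - by have [A CA Aij] := Uw ij.1 ij.2; exists A => //; split=> //; apply: memC Aij.
  by apply: nA; exists w => i j; apply: (Aw (i, j)); rewrite mem_enum.
exists P; case: badP => [P0|[idP nP]].
  (* The maximal set is not empty: the zero ideal is bad by [nreg0] and would be strictly larger. *)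
  case: (maxP (fun x => x = 0)); last by right.
  by split=> [x /P0//|/(_ 0)/(_ erefl)/P0].
split=> // Q idQ sPQ nQ x Qx; apply: contrapT => nPx.
case: (maxP Q); last by right.
by split=> // sQP; apply: nPx; apply: sQP.
Qed.

Lemma mx_left_regular : exists w, b = w * b * b.
Proof.
suff [w Pw] : mx_left_regular_mod (fun x => x = 0).
  exists w; apply/eqP; rewrite -subr_eq0; apply/eqP/matrixP => i j.
  by rewrite Pw mxE.
apply: contrapT => /exists_maximal_not_regular[P [idP nP maxP]].
apply: (nP); apply: mx_left_regular_mod_prime => // x y Pxy.
apply: contrapT => /not_orP[nPx nPy].
(* If [P] were not prime, this left annihilator of [y] modulo [P] and the right annihilator [PJ] of
   [PI] would be ideals containing [P], with [x] in [PI] and [y] in [PJ]. By maximality [b] is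
   regular modulo both, hence modulo [P]. *)
pose PI u := forall t, P (u * t * y).
pose PJ v := forall u, PI u -> forall t, P (u * t * v).
have idPI : ideal PI.
  split=> [t|u v Iu Iv t|u v w Iv t]; first by rewrite mul0r mul0r; apply: ideal0.
    by rewrite !mulrDl; apply: idealD.
  have -> : u * v * w * t * y = u * (v * (w * t) * y) by rewrite !mulrA.
  exact: idealMl.
have idPJ : ideal PJ.
  split=> [u _ t|v w Jv Jw u Iu t|v w v' Jw u Iu t].
  - by rewrite mulr0; apply: ideal0.
  - by rewrite mulrDr; apply: idealD => //; [apply: Jv | apply: Jw].
  by rewrite !mulrA; apply: idealMr => //; rewrite -(mulrA u); apply: Jw.
apply: nP; apply: (@left_regular_of_mul _ b z bbz (mx_ideal PI) (mx_ideal PJ)).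
- exact: mx_idealP.
- by apply: mx_ideal_mul => // u t v Iu Jv; apply: Jv.
- apply: contrapT => nI; apply: nPx; apply: (maxP PI) => //.
  by move=> u Pu t; apply: idealMr => //; apply: idealMr.
apply: contrapT => nJ; apply: nPy; apply: (maxP PJ) => //.
  by move=> v Pv u _ t; apply: idealMl.
Qed.

End Prime.
End MatrixIdeals.

(** * Multilinearization of a polynomial identity *)

Section Multilinearization.
Variable J : finType.
Implicit Types (T : {set J}) (v : seq J).

Fixpoint words n : seq (seq J) :=
  if n is n'.+1 then [seq j :: v | j <- enum J, v <- words n'] else [:: [::]].

Lemma mem_words n v : (v \in words n) = (size v == n).
Proof.
elim: n v => [|n IHn] [|j v] //=; first by apply/negbTE/allpairsP => -[[? ?]] [].
rewrite eqSS -IHn; apply/allpairsP/idP => [[[i u]] [_ /= un [_ ->]]//|vn].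
by exists (j, v); rewrite mem_enum.
Qed.

Lemma words_uniq n : uniq (words n).
Proof.
elim: n => //= n IHn; apply: allpairs_uniq; rewrite ?enum_uniq //.
by move=> [i u] [j v] _ _ [-> ->].
Qed.

Lemma prod_sum_words (S : pzRingType) (A : eqType) (w : J -> A) T (y : J -> S)
    (r : seq A) :
  \prod_(i <- r) \sum_(j in T | w j == i) y j =
  \sum_(v <- words (size r) | all (mem T) v && (map w v == r)) \prod_(j <- v) y j.
Proof.
elim: r => [|i r IHr]; first by rewrite big_nil big_cons /= !big_nil addr0.
rewrite big_cons IHr big_mkcond /= [RHS]big_mkcond big_allpairs_dep big_enum /=.
rewrite mulr_suml; apply: eq_bigr => j _; rewrite [in LHS]big_mkcond mulr_sumr.
apply: eq_bigr => v _; rewrite /= eqseq_cons big_cons.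
by case: (j \in T); case: (w j == i); case: all; case: (_ == r);
  rewrite /= ?mul0r ?mulr0.
Qed.

(** The sign [(-1)^|J \ T|], as a product over all of [J] to match the expansion of a product of
    binomials over subsets. *)
Definition co_sign T : int := \prod_j (if j \in T then 1 else -1).

(* Inclusion-exclusion: the signed sum over T isolates the words in which every
   letter occurs. *)
Lemma sum_co_sign v :
  \sum_(T : {set J}) (if all (mem T) v then co_sign T else 0) =
  ([forall j, j \in v] : nat)%:Z.
Proof.
transitivity (\prod_j (1 + if j \in v then 0 else -1) : int).
  rewrite bigA_distr; apply: eq_bigr => T _; case: (boolP (all _ v)) => [/allP vT|].
    apply: eq_bigr => j _; case: ifP => // jT; case: ifP => // /vT.
    by rewrite inE jT.
  case/allPn => j vj jT; rewrite (bigD1 j) //= [_ \in T](negPf jT) vj.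
  by rewrite mul0r.
case: (boolP [forall j, j \in v]) => [/forallP vj|/forallPn[j vj]].
  by rewrite big1 // => j _; rewrite vj.
by rewrite (bigD1 j) //= (negPf vj) subrr mul0r.
Qed.

(** Pigeonhole: a word of length at most [#|J|] in which every letter occurs uses each exactly
    once. *)
Lemma words_full_perm n : (n <= #|J|)%N ->
  perm_eq [seq v <- words n | [forall j, j \in v]]
          (if n == #|J| then permutations (enum J) else [::]).
Proof.
move=> nJ; apply: uniq_perm.
- by rewrite filter_uniq ?words_uniq.
- by case: eqP => // _; apply: permutations_uniq.
move=> v; rewrite mem_filter mem_words.
have permE : perm_eq v (enum J) = [forall j, j \in v] && (size v == #|J|).
  apply/idP/andP => [pv|[/forallP vj /eqP sv]].
    split; last by rewrite (perm_size pv) cardE.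
    by apply/forallP => j; rewrite (perm_mem pv) mem_enum.
  apply: uniq_perm => [||j]; rewrite ?enum_uniq ?mem_enum ?vj //.
  by apply: (leq_size_uniq (enum_uniq J)) => [j _|]; rewrite ?vj ?sv ?cardE.
case: (eqVneq n #|J|) => [nE|nJ'].
  by rewrite mem_permutations permE nE.
rewrite in_nil; apply/negP => /andP[/forallP vj /eqP sv].
have := @uniq_leq_size _ (enum J) v (enum_uniq J) (fun j _ => vj j).
by rewrite -cardE sv leqNgt ltn_neqAle nJ' nJ.
Qed.

End Multilinearization.

(** Full polarization along a highest monomial [w0] of coefficient 1. There is one new variable per
    position of [w0], and each old variable is replaced by the sum of the new ones at its positions
    in [T]. The signed sum over [T] keeps the words using every new variable; as no monomial is
    longer than [w0], these are permutations. *)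
Lemma PI_ring_multilinear (S : pzRingType) : PI_ring S ->
  exists d (a : seq 'I_d -> int),
    a (enum 'I_d) = 1 /\ forall y : 'I_d -> S, mlin (enum 'I_d) a y = 0.
Proof.
case=> k [g [[w0 gw0 maxw0] g0]].
pose d := size w0; pose w (j : 'I_d) := tnth (in_tuple w0) j.
(* A permutation [u] of the positions arises only from the monomial that it spells in the old
   variables; the identity spells [w0]. *)
exists d, (fun u => g@_(FMonom (map w u))); split.
  by rewrite [map w _]map_tnth_enum fmK.
move=> y; pose sT (T : {set 'I_d}) i := \sum_(j in T | w j == i) y j.
have -> : (0 : S) = \sum_(T : {set 'I_d}) nceval (sT T) g *~ co_sign T.
  by rewrite big1 // => T _; rewrite g0 mul0rz.
transitivity (\sum_(x <- msupp g) \sum_(u <- permutations (enum 'I_d) | map w u == x)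
    (\prod_(i <- u) y i) *~ g@_x).
  rewrite /mlin; under [RHS]eq_bigr do rewrite big_mkcond.
  rewrite exchange_big; apply: eq_bigr => u _ /=.
  have [xg|xg] := boolP (FMonom (map w u) \in msupp g); last first.
    rewrite (mcoeff_outdom xg) mulr0z big_seq big1 // => x xin.
    by case: eqP => // ux; case/negP: xg; rewrite ux fmK.
  rewrite (bigD1_seq (FMonom (map w u))) ?fset_uniq //= ifT //.
  rewrite [X in _ + X]big1 ?addr0 // => x /eqP nxu.
  by case: eqP => // ux; case: nxu; rewrite ux fmK.
under [RHS]eq_bigr do rewrite /nceval mulrz_suml.
rewrite exchange_big /=; apply: eq_big_seq => x xg.
have lexd : (size x <= #|'I_d|)%N by rewrite card_ord; apply: maxw0.
transitivity (\sum_(v <- words 'I_d (size x) | map w v == x)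
   (\prod_(j <- v) y j) *~ g@_x *~ ([forall j, j \in v] : nat)%:Z).
  transitivity (\sum_(v <- [seq v <- words 'I_d (size x) | [forall j, j \in v]]
      | map w v == x) (\prod_(j <- v) y j) *~ g@_x).
    rewrite (perm_big _ (words_full_perm lexd)); case: eqP => // nsx.
    rewrite big_nil big_seq_cond big1 // => u; rewrite mem_permutations.
    case/andP=> /perm_size su /eqP ux; case: nsx.
    by rewrite -ux size_map su cardE.
  rewrite big_filter_cond [LHS]big_mkcond [RHS]big_mkcond; apply: eq_bigr => v _.
  by case: [forall j, _]; case: (_ == _).
rewrite (eq_bigr _ (fun v _ => congr1 _ (esym (sum_co_sign v)))).
under eq_bigr do rewrite mulrz_sumr.
rewrite exchange_big /=; apply: eq_bigr => T _.
rewrite prod_sum_words mulrz_suml mulrz_suml [RHS]big_mkcond [LHS]big_mkcond.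
apply: eq_bigr => v _ /=.
by case: all; case: eqP => //=.
Qed.

Theorem corollary10 (S : pzRingType) (m : nat) (A : 'M[S]_m) (n : nat) :
  PI_ring S -> (0 < n)%N ->
  (exists X : 'M[S]_m, A ^+ n = A ^+ n.+1 * X) ->
  exists Y : 'M[S]_m, A ^+ n = Y * A ^+ n.+1.
Proof.
move=> /PI_ring_multilinear[d [a [a1 id0]]] n0 [X AX].
have AXk k : A ^+ n = A ^+ n * A ^+ k * X ^+ k.
  elim: k => [|k IHk]; first by rewrite !mulr1.
  have AXS : A ^+ n * A ^+ k = A ^+ n * A ^+ k.+1 * X.
    by rewrite -exprD addnC exprD {1}AX mulrA -!exprD addnS -addSn addnC.
  by rewrite {1}IHk AXS -mulrA -exprS.
(* Taking [k = n] in [AXk] gives [b = b * b * z] for [b = A ^+ n] and [z = X ^+ n]. *)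
have [w Aw] := mx_left_regular (enum_uniq 'I_d) a1 id0 (AXk n).
exists (w * A ^+ n.-1).
by rewrite {1}Aw -!mulrA -!exprD addnS -addSn prednK.
Qed.
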